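(* Let $n$ nodes run the algorithm TLCB described in the context. Suppose $0<t_r\le n-f$, $0<t_s\le t_r$, and $0<t_b\le n-f_b$ where $f_b=t_r(n-t_r)/(t_r-t_s+1)$, and at most $f$ nodes fail. Then TLCB (with the $k$-th call to TLCB on a node constituting that node's $k$-th logical time-step) implements a $\mathrm{TSB}(t_r,t_b,t_s)$ partial-spread broadcast abstraction.
   Context: Asynchronous network model. There are $n$ nodes numbered $1,\dots,n$; nodes may fail only by crashing permanently, after which they send no messages. A network-level Broadcast sends a message to all $n$ nodes (including the sender). Every message sent to a node that does not fail is eventually delivered after an arbitrary finite delay, and messages between each pair of nodes are delivered in the order sent. $\mathrm{Receive}()$ waits for and returns the next delivered message. Algorithm TLCR (node $i$, receive threshold $t_r$). Persistent state: a list $\vec R$ of sets, initially $[\{\}]$; $\vec R_k$ is its $k$-th element. On a call $\mathrm{TLCR}(m)$: append $\{\}$ to $\vec R$ and let $s=|\vec R|$; network-broadcast $\langle i,m,s,\vec R_{s-1}\rangle$; while $|\vec R_s|<t_r$: receive $\langle j,m',s',R'\rangle$; if $s'=s$, add $\langle j,m'\rangle$ to $\vec R_s$; else if $s'>s$, set $\vec R_s\leftarrow\vec R_s\cup R'$ (messages with $s'<s$ are ignored). Return $(\{m'\mid\langle j,m'\rangle\in\vec R_s\},\{\})$. Algorithm TLCB (node $i$, thresholds $t_r$, $t_s\le t_r$), built on TLCR with receive threshold $t_r$. On a call $\mathrm{TLCB}(m)$: $(R',\_)\leftarrow\mathrm{TLCR}(m)$; $(R'',\_)\leftarrow\mathrm{TLCR}(R')$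 (so $R''$ is a set of message-sets); $R\leftarrow R'\cup\bigcup_{X\in R''}X$; $B\leftarrow\{m'\mid$ at least $t_s$ of the message-sets in $R''$ contain $m'\}$; return $(R,B)$. Thus each TLCB step uses two TLCR steps. Threshold synchronous broadcast. A primitive, called once per logical time-step by each non-failed node with a message $m$ and returning a pair $(R,B)$ of message sets, provides $\mathrm{TSB}(t_r,t_b,t_s)$ if: (lock-step synchrony) a call at step $s$ returns (completing step $s$) unless the node fails first; (receive threshold) if node $i$'s call at step $s$ returns $(R,B)$, there is $N_R\subseteq\{1,\dots,n\}$ with $|N_R|\ge t_r$ such that $R$ is exactly the set of messages broadcast by the nodes of $N_R$ in step $s$; (broadcast threshold) there is $N_B\subseteq\{1,\dots,n\}$ with $|N_B|\ge t_b$ such that $B$ is exactly the set of messages broadcast by the nodes of $N_B$ in step $s$; (spread threshold) each $m'\in B$ returned to any node at step $s$ is contained in the receive sets $R$ returned in step $s$ to at least $t_s$ nodes (counting nodes that fail before completing step $s$ but would otherwise have received $m'$).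
   Formalization: In forming B, the message-sets in R'' are counted once per sending node rather than as a set with equal sets merged; with merging, all nodes gathering the same R' would make B empty whenever t_s is at least 2, and the claim would fail. *)

(* Defs.v *)
From HB Require Import structures.
From mathcomp Require Import all_boot all_order all_algebra finmap.
Set Implicit Arguments. Unset Strict Implicit. Unset Printing Implicit Defensive.
Import GRing.Theory Num.Theory.

Local Open Scope fset_scope.

(* Nodes are 'I_n (the paper's nodes 1..n, shifted by one).                 *)
(* Application messages have an arbitrary type M (a choiceType so that we   *)
(* can form finite sets of them).                                            *)

(* A TLCR payload: either an application message (first TLCR of a TLCB     *)
(* step) or a set of application messages (second TLCR of a TLCB step).     *)
Notation payload M := (M + {fset M})%type.

Notation rpair n M := ('I_n * payload M)%type.

Record netmsg (n : nat) (M : choiceType) := NetMsg {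
  nm_sender : 'I_n;
  nm_payload : payload M;
  nm_step : nat;
  nm_prev : {fset rpair n M}
}.

Inductive phase (M : choiceType) :=
| Idle
| Round1                      (* inside the first TLCR call of TLCB *)
| Round2 of {fset M}.         (* inside the second TLCR call; stores R' *)
Arguments Idle {M}.
Arguments Round1 {M}.

(* Global state.  [stepc i] is |\vec R| for node i; [Rv i k] is \vec R_k.   *)
(* [chan a b] is the FIFO queue of messages sent by a to b and not yet      *)
(* delivered; [inbox b] is the queue of delivered, not yet received         *)
(* messages of b (Receive() returns its head).  [ncalls], [bcast], [out]    *)
(* are history variables: number of TLCB calls made, the message given to   *)
(* the k-th call (k >= 1), and the pair (R,B) returned by the k-th call.    *)
Record state (n : nat) (M : choiceType) := State {
  crashed : 'I_n -> bool;
  phase_of : 'I_n -> phase M;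
  stepc : 'I_n -> nat;
  Rv : 'I_n -> nat -> {fset rpair n M};
  chan : 'I_n -> 'I_n -> seq (netmsg n M);
  inbox : 'I_n -> seq (netmsg n M);
  ncalls : 'I_n -> nat;
  bcast : 'I_n -> nat -> option M;
  out : 'I_n -> nat -> option ({fset M} * {fset M})
}.

Inductive event (n : nat) (M : choiceType) :=
| Call of 'I_n & M
| Deliver of 'I_n & 'I_n
| Recv of 'I_n
| Crash of 'I_n
| Skip.
Arguments Skip {n M}.
Arguments Call {n M}.
Arguments Deliver {n M}.
Arguments Recv {n M}.
Arguments Crash {n M}.

Definition upd (A : eqType) (B : Type) (f : A -> B) (a : A) (b : B) : A -> B :=
  fun x => if x == a then b else f x.

Definition init_state (n : nat) (M : choiceType) : state n M :=
  State (fun _ => false) (fun _ => Idle) (fun _ => 1%N) (fun _ _ => fset0)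
        (fun _ _ => [::]) (fun _ => [::]) (fun _ => 0%N)
        (fun _ _ => None) (fun _ _ => None).

Definition tlcr_start (n : nat) (M : choiceType) (st : state n M) (i : 'I_n) (p : payload M)
    (ph : phase M) : state n M :=
  let s := (stepc st i).+1 in
  let msg := NetMsg i p s (Rv st i (stepc st i)) in
  State (crashed st) (upd (phase_of st) i ph) (upd (stepc st) i s)
        (upd (Rv st) i (upd (Rv st i) s fset0))
        (fun a b => if a == i then rcons (chan st a b) msg else chan st a b)
        (inbox st) (ncalls st) (bcast st) (out st).

Definition getl (M : choiceType) (p : payload M) : option M :=
  if p is inl m then Some m else None.
Definition getr (M : choiceType) (p : payload M) : option {fset M} :=
  if p is inr X then Some X else None.

Definition tlcr_result1 (n : nat) (M : choiceType) (Rs : {fset rpair n M}) : {fset M} :=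
  [fset m | m in pmap (fun q : rpair n M => getl q.2) Rs].

(* Result of TLCB from R' and the final \vec R_s of the second TLCR call.   *)
(* R'' is the collection of message-sets <j, X> in \vec R_s (counted per    *)
(* sending node).                                              *)
Definition tlcb_R (n : nat) (M : choiceType) (R1 : {fset M}) (Rs : {fset rpair n M}) : {fset M} :=
  R1 `|` \bigcup_(X <- pmap (fun q : rpair n M => getr q.2) Rs) X.

Definition nsets_containing (n : nat) (M : choiceType) (Rs : {fset rpair n M}) (m : M) : nat :=
  count (fun q : rpair n M => if q.2 is inr X then m \in X else false) Rs.

Definition tlcb_B (n : nat) (M : choiceType) (t_s : nat) (Rs : {fset rpair n M}) : {fset M} :=
  [fset m in \bigcup_(X <- pmap (fun q : rpair n M => getr q.2) Rs) X
     | (t_s <= nsets_containing Rs m)%N].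

(* One Receive() step inside a TLCR loop, including the return of the TLCR  *)
(* call (and possibly of TLCB) once |\vec R_s| >= t_r.                      *)
Definition recv_step (n : nat) (M : choiceType) (t_r t_s : nat) (st : state n M) (i : 'I_n) : state n M :=
  if crashed st i then st else
  match phase_of st i, inbox st i with
  | Idle, _ => st
  | _, [::] => st
  | ph, x :: rest =>
    let s := stepc st i in
    let R := Rv st i s in
    let R' :=
      if nm_step x == s then R `|` [fset (nm_sender x, nm_payload x)]
      else if (s < nm_step x)%N then R `|` nm_prev x
      else R in
    let st1 := State (crashed st) (phase_of st) (stepc st)
                     (upd (Rv st) i (upd (Rv st i) s R'))
                     (chan st) (upd (inbox st) i rest)
                     (ncalls st) (bcast st) (out st) in
    if (#|` R'| < t_r)%N then st1 else
    match ph with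
    | Idle => st1
    | Round1 =>
        let R1 := tlcr_result1 R' in
        tlcr_start st1 i (inr R1) (Round2 R1)
    | Round2 R1 =>
        State (crashed st1) (upd (phase_of st1) i Idle) (stepc st1) (Rv st1)
              (chan st1) (inbox st1) (ncalls st1) (bcast st1)
              (upd (out st1) i (upd (out st1 i) (ncalls st1 i)
                      (Some (tlcb_R R1 R', tlcb_B t_s R'))))
    end
  end.

Definition step (n : nat) (M : choiceType) (t_r t_s : nat) (st : state n M) (e : event n M) : state n M :=
  match e with
  | Call i m =>
      if crashed st i then st else
      if phase_of st i is Idle then
        let k := (ncalls st i).+1 in
        let st1 := State (crashed st) (phase_of st) (stepc st) (Rv st)
                         (chan st) (inbox st) (upd (ncalls st) i k)
                         (upd (bcast st) i (upd (bcast st i) k (Some m)))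
                         (out st) in
        tlcr_start st1 i (inl m) Round1
      else st
  | Deliver a b =>
      match chan st a b with
      | [::] => st
      | x :: rest =>
        State (crashed st) (phase_of st) (stepc st) (Rv st)
              (fun a' b' => if (a' == a) && (b' == b) then rest else chan st a' b')
              (upd (inbox st) b (rcons (inbox st b) x))
              (ncalls st) (bcast st) (out st)
      end
  | Recv i => recv_step t_r t_s st i
  | Crash i =>
      State (upd (crashed st) i true) (phase_of st) (stepc st) (Rv st)
            (chan st) (inbox st) (ncalls st) (bcast st) (out st)
  | Skip => st
  end.

Fixpoint run (n : nat) (M : choiceType) (t_r t_s : nat) (ev : nat -> event n M) (t : nat) : state n M :=
  match t with
  | 0 => init_state n M
  | t'.+1 => step t_r t_s (run t_r t_s ev t') (ev t')
  end.

(* Admissible executions: at most f nodes ever fail; every message sent to  *)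
(* a node that does not fail is eventually delivered (FIFO per channel by   *)
(* construction); a non-failed node eventually performs its Receive() steps;*)
(* the environment eventually makes the next TLCB call at every non-failed  *)
(* node (one call per logical time-step).                                   *)
Definition admissible (n : nat) (M : choiceType) (t_r t_s f : nat) (ev : nat -> event n M) : Prop :=
  [/\ (forall t, #|[set i | crashed (run t_r t_s ev t) i]| <= f)%N,
      (forall a b t, exists2 t', (t <= t')%N &
          ev t' = Deliver a b \/ crashed (run t_r t_s ev t') b),
      (forall i t, exists2 t', (t <= t')%N &
          ev t' = Recv i \/ crashed (run t_r t_s ev t') i) &
      (forall i t, exists2 t', (t <= t')%N &
          (exists m, ev t' = Call i m) \/ crashed (run t_r t_s ev t') i)].

Definition broadcast_in (n : nat) (M : choiceType) (t_r t_s : nat) (ev : nat -> event n M)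
    (i : 'I_n) (k : nat) (m : M) : Prop :=
  exists t, bcast (run t_r t_s ev t) i k = Some m.

Definition returned (n : nat) (M : choiceType) (t_r t_s : nat) (ev : nat -> event n M)
    (i : 'I_n) (k : nat) (R B : {fset M}) : Prop :=
  exists t, out (run t_r t_s ev t) i k = Some (R, B).

Definition fails (n : nat) (M : choiceType) (t_r t_s : nat) (ev : nat -> event n M) (i : 'I_n) : Prop :=
  exists t, crashed (run t_r t_s ev t) i.

Definition exactly_from (n : nat) (M : choiceType) (t_r t_s : nat) (ev : nat -> event n M)
    (N : {set 'I_n}) (k : nat) (X : {fset M}) : Prop :=
  (forall j, j \in N -> exists m, broadcast_in t_r t_s ev j k m) /\
  (forall m, m \in X <-> exists2 j, j \in N & broadcast_in t_r t_s ev j k m).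

(* Node j receives m in step k, counting a node that fails (at time T) as   *)
(* receiving m if it would otherwise have received it: in every admissible  *)
(* execution that coincides with this one before the crash, whenever j      *)
(* completes step k, its receive set contains m.                            *)
Definition would_receive (n : nat) (M : choiceType) (t_r t_s f : nat) (ev : nat -> event n M)
    (j : 'I_n) (k : nat) (m : M) : Prop :=
  (exists R B, returned t_r t_s ev j k R B /\ m \in R) \/
  (exists T, [/\ ev T = Crash j, ~~ crashed (run t_r t_s ev T) j &
     forall ev' : nat -> event n M, admissible t_r t_s f ev' ->
       (forall t, (t < T)%N -> ev' t = ev t) ->
       forall R B, returned t_r t_s ev' j k R B -> m \in R]).

Definition TSB (n : nat) (M : choiceType) (t_r t_s f : nat) (ev : nat -> event n M)
    (tr tb ts : nat) : Prop :=
  [/\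
      (forall i k m, broadcast_in t_r t_s ev i k m ->
         (exists R B, returned t_r t_s ev i k R B) \/ fails t_r t_s ev i),
      (forall i k R B, returned t_r t_s ev i k R B ->
         exists N : {set 'I_n}, (tr <= #|N|)%N /\ exactly_from t_r t_s ev N k R),
      (forall i k R B, returned t_r t_s ev i k R B ->
         exists N : {set 'I_n}, (tb <= #|N|)%N /\ exactly_from t_r t_s ev N k B) &
      (forall i k R B m, returned t_r t_s ev i k R B -> m \in B ->
         exists N : {set 'I_n}, (ts <= #|N|)%N /\
           forall j, j \in N -> would_receive t_r t_s f ev j k m)].

Definition f_b (n t_r t_s : nat) : rat :=
  ((t_r%:R * (n%:R - t_r%:R)) / (t_r%:R - t_s%:R + 1))%R.

(* Main.v *)
(* TLCR step [s] of a node ends at the latest when a message of step [s + 1]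
   arrives, because that message carries a full receive set of step [s]; since
   channels are FIFO, a node therefore never sees a message more than one step
   ahead of its own, and receive sets of different steps are never mixed.

   Liveness: a node entering step [s] has discarded the step-[s] messages that
   it received earlier, but the first non-failing node to enter step [s] has
   discarded none from the non-failing nodes, so it collects at least
   [n - f >= t_r] of them.  Its next message then releases all the others.

   Broadcast threshold: each of the [q >= t_r] sets gathered in the second round
   misses at most [n - t_r] nodes, while a node whose message is not in [B] is
   missed by at least [q - t_s + 1] sets; so there are at most
   [q (n - t_r) / (q - t_s + 1) <= f_b] such nodes.

   Spread: a node that sent [X] in the second round returns [R] containing [X],
   in every execution that extends the prefix in which it sent [X]. *)
Require Import Defs.
From HB Require Import structures.
From mathcomp Require Import all_boot all_order all_algebra finmap zify.
From Stdlib Require Import Classical.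
Import Order.POrderTheory GRing.Theory Num.Theory.

Set Implicit Arguments.
Unset Strict Implicit.
Unset Printing Implicit Defensive.

(** * Decidable equality of network messages *)

Definition netmsg_tuple (n : nat) (M : choiceType) (x : netmsg n M) :=
  (nm_sender x, nm_payload x, nm_step x, nm_prev x).
Definition tuple_netmsg (n : nat) (M : choiceType)
    (y : 'I_n * payload M * nat * {fset rpair n M}) : netmsg n M :=
  let: (j, p, s, R) := y in NetMsg j p s R.
Lemma netmsg_tupleK (n : nat) (M : choiceType) :
  cancel (@netmsg_tuple n M) (@tuple_netmsg n M).
Proof. by case. Qed.
HB.instance Definition _ (n : nat) (M : choiceType) :=
  Equality.copy (netmsg n M) (can_type (@netmsg_tupleK n M)).

(** The pairs [(a, j)] with [a] in [S], [j] in [W] and [j] in [D a] are counted in two ways: each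
    [D a] misses at most [#|T| - r] points, and each [j] lies in fewer than [s] of the sets. *)
Lemma double_counting (T : finType) (S W : {set T}) (D : T -> {set T}) (r s : nat) :
  0 < s <= r -> r <= #|S| ->
  (forall a, a \in S -> r <= #|D a|) ->
  (forall j, j \in W -> #|[set a in S | j \in D a]| < s) ->
  #|W| * (r - s).+1 <= r * (#|T| - r).
Proof.
move=> s_r rS HD HW.
have rT : r <= #|T| by apply: leq_trans rS (max_card _).
have lower : #|S| * (r - (#|T| - #|W|)) <= \sum_(a in S) #|D a :&: W|.
  rewrite -sum_nat_const; apply: leq_sum => a aS.
  have := cardsUI (D a) W; have := max_card (D a :|: W); have := HD a aS.
  by have := max_card W; lia.
have upper : \sum_(a in S) #|D a :&: W| <= #|W| * s.-1.
  have -> : \sum_(a in S) #|D a :&: W| = \sum_(j in W) #|[set a in S | j \in D a]|.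
    under eq_bigr => a _ do rewrite -sum1_card big_mkcond /=.
    rewrite exchange_big /= [RHS]big_mkcond /=; apply: eq_bigr => j _.
    case: ifP => jW; last by rewrite big1 // => a _; rewrite inE jW andbF.
    rewrite -sum1_card [RHS]big_mkcond [LHS]big_mkcond /=; apply: eq_bigr => a _.
    by rewrite !inE jW andbT; case: (a \in S).
  by rewrite -sum_nat_const; apply: leq_sum => j /HW; lia.
(* If [#|W| <= #|T| - r], then [(r - s).+1 <= r] suffices; otherwise [#|S|] may be lowered to [r] in
   the lower bound. *)
have := leq_trans lower upper; have := max_card W; nia.
Qed.

(** * Counting and eventuality *)

Lemma le_f_b (n r s w : nat) : s <= r <= n ->
  w * (r - s).+1 <= r * (n - r) -> (w%:R <= f_b n r s)%R.
Proof.
move=> /andP[sr rn] le; rewrite /f_b -!natrB // natr1.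
by rewrite ler_pdivlMr ?ltr0Sn // -!natrM ler_nat.
Qed.

(** Until [Q] occurs, [P] persists, [mu] never grows and each fair step lowers it; as fair steps
    recur, [Q] must occur. With a constant [mu], a fair step must itself give [Q]. *)
Lemma leads_to (P Q fair : nat -> Prop) (mu : nat -> nat) :
  (forall t, exists2 t', t <= t' & fair t') ->
  (forall t, P t ->
    Q t.+1 \/ [/\ P t.+1, mu t.+1 <= mu t & fair t -> mu t.+1 < mu t]) ->
  forall t, P t -> exists2 t', t <= t' & Q t'.
Proof.
move=> Hfair Hstep t; have [u] := ubnP (mu t).
elim: u t => // u IH t /ltnSE mu_u Pt; have [t' tt' Ft'] := Hfair t.
have {Pt} : (exists2 t'', t <= t'' & Q t'') \/ P t' /\ mu t' <= mu t.
  move: tt' {Ft'}; elim: t' => [|t' IHt].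
    by rewrite leqn0 => /eqP E; subst t; right.
  rewrite leq_eqVlt => /orP[/eqP<-|/ltnSE tt']; first by right.
  case: (IHt tt') => [|[Pt' le]]; first by left.
  case: (Hstep t' Pt') => [Qt'|[Pt1 le1 _]]; first by left; exists t'.+1 => //; lia.
  by right; split=> //; lia.
case=> [//|[Pt' le]]; case: (Hstep t' Pt') => [Qt'|[Pt1 le1 /(_ Ft') lt]].
  by exists t'.+1 => //; lia.
by have [|//|t'' tt'' Qt''] := IH t'.+1; first lia; exists t'' => //; lia.
Qed.

Lemma eventually_all (T : finType) (P : T -> nat -> Prop) :
  (forall i, exists t, forall t', t <= t' -> P i t') ->
  exists t, forall t', t <= t' -> forall i, P i t'.
Proof.
case/fin_all_exists => g Hg; exists (\max_i g i) => t' le i.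
exact: Hg (leq_trans (leq_bigmax i) le).
Qed.

(** * Sent and pending messages, read off the state *)

Section Execution.

Context (n : nat) (M : choiceType) (t_r t_s : nat).
Implicit Types (st : state n M) (i j a b : 'I_n) (x : netmsg n M).
Implicit Types (k s : nat) (q : rpair n M) (C : {set 'I_n}).

Definition active (ph : phase M) : bool := if ph is Idle then false else true.

(* The k-th TLCB call occupies TLCR steps 2k and 2k + 1; step 1 is the initial
   empty entry of the list and carries no message. *)
Definition payload_at st j s : option (payload M) :=
  if odd s then Some (inr (tlcr_result1 (Rv st j s.-1)))
  else omap inl (bcast st j s./2).

(** No log of messages is kept: what [q.1] sent in step [s] is recomputed from the state, which
    yields at most one payload per node and step. *)
Definition sent st s q : Prop :=
  (1 < s <= stepc st q.1) /\ payload_at st q.1 s = Some q.2.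

Definition valid_msg st x : Prop :=
  sent st (nm_step x) (nm_sender x, nm_payload x) /\
  nm_prev x = Rv st (nm_sender x) (nm_step x).-1.

(** In FIFO order: the messages of [a] in the inbox of [b] precede those still in the channel, so a
    delivery leaves the list unchanged. *)
Definition pend st a b : seq (netmsg n M) :=
  [seq x <- inbox st b | nm_sender x == a] ++ chan st a b.

(** The bound on [s] is strict because the entry of the current step still changes. *)
Record grows st st' : Prop := Grows {
  grows_stepc : forall i, stepc st i <= stepc st' i;
  grows_Rv : forall i s, s < stepc st i -> Rv st' i s = Rv st i s;
  grows_bcast : forall i k m, bcast st i k = Some m -> bcast st' i k = Some m
}.

Lemma grows_refl st : grows st st.
Proof. by split. Qed.

Lemma grows_trans st1 st2 st3 : grows st1 st2 -> grows st2 st3 -> grows st1 st3.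
Proof.
move=> [H1 H2 H3] [K1 K2 K3]; split.
- by move=> i; apply: leq_trans (H1 i) (K1 i).
- by move=> i s lt_s; rewrite K2 ?H2 //; apply: leq_trans lt_s (H1 i).
- by move=> i k m /H3 /K3.
Qed.

(** A step-[s] message depends on entry [s.-1] or on the argument of a call, and both are fixed once
    its sender is at step [s]. *)
Lemma sent_grows st st' s q : grows st st' -> sent st s q -> sent st' s q.
Proof.
move=> [H1 H2 H3] [/andP[s1 sq] Eq]; split.
  by rewrite s1 (leq_trans sq) ?H1.
move: Eq; rewrite /payload_at; case: ifP => _.
  by rewrite H2 //; case: s s1 sq.
by case E: (bcast st _ _) => [m|] //= [<-]; rewrite (H3 _ _ _ E).
Qed.

Lemma valid_grows st st' x : grows st st' -> valid_msg st x -> valid_msg st' x.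
Proof.
move=> g [Hs Hp]; split; first exact: sent_grows g Hs.
case: g => _ -> //; case: Hs => /= /andP[s1 sq] _.
by case: (nm_step x) s1 sq.
Qed.

(** * The network invariant *)

(* The last alternative of [ni_fifo]: a node that has received a message of the
   step following its own adopted a full receive set from it, so it has left
   its loop.  This is what makes [Rv := Rv `|` nm_prev] merge sets of one and
   the same step only.

   [ni_kept]: the first node of [C] to have reached step [s] did so before any
   other node of [C] had sent a step-[s] message, so it discarded none of them. *)
Record net_inv st : Prop := NetInv {
  ni_quorum : forall i s, 1 < s < stepc st i -> t_r <= #|` Rv st i s|;
  ni_sent : forall i s q, q \in Rv st i s -> sent st s q;
  ni_inbox : forall b x, x \in inbox st b -> valid_msg st x;
  ni_chan : forall a b x, x \in chan st a b ->
    valid_msg st x /\ nm_sender x = a;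
  ni_fifo : forall a b, exists r,
    [/\ 0 < r <= stepc st a,
        map (@nm_step n M) (pend st a b) = iota r.+1 (stepc st a - r) &
        r <= stepc st b \/
        r = (stepc st b).+1 /\ t_r <= #|` Rv st b (stepc st b)|];
  ni_kept : forall s C, 1 < s -> C != set0 ->
    (forall i, i \in C -> stepc st i = s) ->
    exists2 i, i \in C & forall j, j \in C ->
      (exists p, (j, p) \in Rv st i s) \/
      s \in map (@nm_step n M) (pend st j i)
}.

Lemma net_init : net_inv (init_state n M).
Proof.
split=> //=.
- by move=> i s; lia.
(* Nothing is sent in step 1, so [r = 1] describes an empty pending list. *)
- by move=> a b; exists 1; split=> //; left.
- move=> s C s1 /set0Pn[i iC] /(_ i iC); lia.
Qed.

Lemma net_bookkeeping st cr ph nc bc o :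
  (forall i k m, bcast st i k = Some m -> bc i k = Some m) -> net_inv st ->
  net_inv (State cr ph (stepc st) (Rv st) (chan st) (inbox st) nc bc o).
Proof.
move=> Hbc [H1 H2 H3 H4 H5 H6].
set st' := State _ _ _ _ _ _ _ _ _.
have g : grows st st' by split.
split=> //.
- by move=> i s q /H2; apply: sent_grows.
- by move=> b x /H3; apply: valid_grows.
- by move=> a b x /H4[Hx ->]; split=> //; apply: valid_grows Hx.
Qed.

Lemma grows_start st i p ph : grows st (tlcr_start st i p ph).
Proof.
split=> //= j.
- by rewrite /upd; case: eqP => // ->.
- move=> s; rewrite /upd; have [->|//] := eqVneq j i.
  by have [->|//] := eqVneq s (stepc st i).+1; lia.
Qed.

Lemma pend_start st i p ph a b :
  pend (tlcr_start st i p ph) a b =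
  if a == i then rcons (pend st a b)
    (NetMsg i p (stepc st i).+1 (Rv st i (stepc st i)))
  else pend st a b.
Proof. by rewrite /pend /=; case: ifP => // _; rewrite rcons_cat. Qed.

(** Entering a new step closes the current entry, which must therefore be full unless it is the
    initial one. *)
Lemma net_start st i p ph :
  net_inv st -> 0 < stepc st i ->
  stepc st i = 1 \/ t_r <= #|` Rv st i (stepc st i)| ->
  payload_at st i (stepc st i).+1 = Some p ->
  net_inv (tlcr_start st i p ph).
Proof.
move=> [H1 H2 H3 H4 H5 H6] i0 Hq Hp.
have g := grows_start st i p ph.
have vnew : valid_msg (tlcr_start st i p ph)
    (NetMsg i p (stepc st i).+1 (Rv st i (stepc st i))).
  split=> /=; last by rewrite /upd eqxx; case: eqP => //; lia.
  split=> /=; first by rewrite /upd eqxx; lia.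
  rewrite -Hp /payload_at /= /upd eqxx; case: ifP => //.
  by case: eqP => //; lia.
split.
- move=> j s /=; rewrite /upd; have [_|_] := eqVneq j i; last exact: H1.
  move=> lt_s; have [E|_] := eqVneq s (stepc st i).+1; first lia.
  have [E|ne] := eqVneq s (stepc st i); last by apply: H1; lia.
  by rewrite E; case: Hq => // E1; lia.
- move=> j s q /= Hin; apply: sent_grows g _; apply: H2 (j) _ _ _.
  by move: Hin; rewrite /upd; have [->|] := eqVneq j i => //; case: eqVneq.
- by move=> b x /H3; apply: valid_grows g.
- move=> a b x /=; case: eqP => [->|_].
    rewrite mem_rcons inE => /orP[/eqP->|/H4[Hx ->]] //.
    by split=> //; apply: valid_grows g _.
  by move=> /H4[Hx ->]; split=> //; apply: valid_grows g _.
- move=> a b; have [r [r0 Hr rb]] := H5 a b; exists r; split.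
  + by have := grows_stepc g a; lia.
  + rewrite pend_start /= /upd; case: eqP => [E|//]; subst a.
    rewrite map_rcons Hr /= subSn; last by lia.
    by rewrite -[(_ - r).+1]addn1 iotaD cats1; congr rcons; lia.
  (* When [b] itself moves on, the second alternative turns into [r <= stepc b]. *)
  + rewrite /= /upd; have [E|_] := eqVneq b i; last exact: rb.
    by subst b; left; case: rb => [|[]]; lia.
- move=> s C s1 C0 HC.
  have HC' j : j \in C -> j != i -> stepc st j = s.
    by move=> jC ne; rewrite -(HC j jC) /= /upd (negPf ne).
  have [iC|iC] := boolP (i \in C); last first.
    have neC j : j \in C -> j != i by apply: contraTneq => ->.
    have [j jC Hj] := H6 s C s1 C0 (fun j jC => HC' j jC (neC j jC)).
    exists j => // a aC; rewrite pend_start (negPf (neC a aC)) /= /upd.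
    by rewrite (negPf (neC j jC)); apply: Hj.
  (* Here [i] is the last node of [C] to reach step [s], and its message is still pending
     everywhere, so a witness for [C :\ i] serves. If [C] has no other node, [i] serves, its message
     to itself being pending. *)
  have si : s = (stepc st i).+1 by rewrite -(HC i iC) /= /upd eqxx.
  have iin j : s \in map (@nm_step n M) (pend (tlcr_start st i p ph) i j).
    by rewrite pend_start eqxx map_rcons mem_rcons inE /= si eqxx.
  have [C1|C1] := eqVneq (C :\ i) set0.
    exists i => // j jC; right; suff -> : j = i by [].
    apply/eqP; apply: contraTT isT => ne.
    by have := in_set0 j; rewrite -C1 !inE ne jC.
  have [|j] := H6 s (C :\ i) s1 C1.
    by move=> j; rewrite !inE => /andP[ne jC]; apply: HC'.
  rewrite !inE => /andP[ne jC] Hj; exists j => // a aC.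
  have [->|nea] := eqVneq a i; first by right.
  rewrite pend_start (negPf nea) /= /upd (negPf ne); apply: Hj.
  by rewrite !inE nea.
Qed.

Lemma pend_deliver st a b x rest a' b' :
  chan st a b = x :: rest -> nm_sender x = a ->
  pend (step t_r t_s st (Deliver a b)) a' b' = pend st a' b'.
Proof.
move=> Ec xa; rewrite /pend /= Ec /= /upd.
have [->|_] := eqVneq b' b; last by rewrite andbF.
rewrite filter_rcons xa [a == a']eq_sym andbT.
by have [->|//] := eqVneq a' a; rewrite Ec cat_rcons.
Qed.

Lemma net_deliver st a b :
  net_inv st -> net_inv (step t_r t_s st (Deliver a b)).
Proof.
move=> Hst; case Ec: (chan st a b) => [|x rest]; first by rewrite /= Ec.
have [H1 H2 H3 H4 H5 H6] := Hst.
have [vx xa] : valid_msg st x /\ nm_sender x = a.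
  by apply: (H4 a b); rewrite Ec mem_head.
have Hp := pend_deliver _ _ Ec xa.
have g : grows st (step t_r t_s st (Deliver a b)) by rewrite /= Ec.
split.
- by move=> i s; rewrite /= Ec; apply: H1.
- by move=> i s q; rewrite [X in _ \in X -> _]/= Ec => /H2; apply: sent_grows.
- move=> c y; rewrite [X in _ \in X -> _]/= Ec /= /upd => Hy; apply: valid_grows g _.
  move: Hy; have [_|_] := eqVneq c b; last exact: H3.
  by rewrite mem_rcons inE => /orP[/eqP-> //|/H3].
- move=> c d y; rewrite [X in _ \in X -> _]/= Ec /= => Hy.
  suff /H4[vy yc] : y \in chan st c d by split=> //; apply: valid_grows g _.
  move: Hy; case: andP => // -[/eqP-> /eqP->] Hy.
  by rewrite Ec inE Hy orbT.
- by move=> c d; have [r] := H5 c d; rewrite Hp /= Ec; exists r.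
- move=> s C s1 C0; rewrite /= Ec /= => HC.
  have [i iC Hi] := H6 s C s1 C0 HC; exists i => // j jC.
  by have := Hp j i; rewrite /= Ec => ->; apply: Hi.
Qed.

(** The updated current entry; [absorb] is the state inside [recv_step] before the loop condition is
    tested. *)
Definition merged st i x : {fset rpair n M} :=
  (if nm_step x == stepc st i
   then Rv st i (stepc st i) `|` [fset (nm_sender x, nm_payload x)]
   else if stepc st i < nm_step x then Rv st i (stepc st i) `|` nm_prev x
   else Rv st i (stepc st i))%fset.

Definition absorb st i x rest : state n M :=
  State (crashed st) (phase_of st) (stepc st)
    (upd (Rv st) i (upd (Rv st i) (stepc st i) (merged st i x)))
    (chan st) (upd (inbox st) i rest) (ncalls st) (bcast st) (out st).

Lemma grows_absorb st i x rest : grows st (absorb st i x rest).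
Proof.
split=> //= j s; rewrite /upd; have [->|//] := eqVneq j i.
by have [->|//] := eqVneq s (stepc st i); rewrite ltnn.
Qed.

Lemma Rv_absorb st i x rest j s : {subset Rv st j s <= Rv (absorb st i x rest) j s}.
Proof.
move=> q; rewrite /= /upd; have [->|//] := eqVneq j i.
have [->|//] := eqVneq s (stepc st i).
by rewrite /merged; case: ifP => _; last case: ifP => _; rewrite ?inE => ->.
Qed.

Lemma pend_absorb st i x rest a b : inbox st i = x :: rest ->
  pend st a b = if (a == nm_sender x) && (b == i)
    then x :: pend (absorb st i x rest) a b else pend (absorb st i x rest) a b.
Proof.
move=> Ei; rewrite /pend /= /upd; have [->|_] := eqVneq b i; last by rewrite andbF.
by rewrite Ei /= eq_sym andbT; case: ifP.
Qed.

(** A short entry excludes the second alternative of [ni_fifo]. Hence [x] is at most one step ahead,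
    and a set merged from it belongs to the current step. *)
Lemma net_absorb st i x rest :
  net_inv st -> inbox st i = x :: rest -> 1 < stepc st i ->
  #|` Rv st i (stepc st i)| < t_r -> net_inv (absorb st i x rest).
Proof.
move=> [H1 H2 H3 H4 H5 H6] Ei i1 Hlt.
set st' := absorb st i x rest.
have g : grows st st' := grows_absorb st i x rest.
have vx : valid_msg st x by apply: (H3 i); rewrite Ei mem_head.
have [/= sx px] := vx.
have x_le : nm_step x <= (stepc st i).+1.
  have [r [r0 Hr rb]] := H5 (nm_sender x) i.
  have {rb} : r <= stepc st i by case: rb => // -[_]; lia.
  move: Hr; rewrite (pend_absorb _ _ Ei) !eqxx /=.
  by case: (_ - r) => [//|d] /= [-> _]; lia.
have x_next : stepc st i < nm_step x -> nm_step x = (stepc st i).+1.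
  by move=> lt; apply/eqP; rewrite eqn_leq x_le lt.
split.
- move=> j s Hs; apply: leq_trans (H1 j s Hs) _.
  by apply: fsubset_leq_card; apply/fsubsetP; apply: Rv_absorb.
- move=> j s q Hq; apply: sent_grows g _; move: Hq.
  rewrite /= /upd; have [_|_] := eqVneq j i; last exact: H2.
  have [->|_] := eqVneq s (stepc st i); last exact: H2.
  rewrite /merged; case: eqP => [<-|_].
    by rewrite !inE => /orP[|/eqP->//]; apply: H2.
  case: ifP => [/x_next E|_]; last exact: H2.
  rewrite inE px => /orP[|]; first exact: H2.
  by rewrite E /=; apply: H2.
- move=> b y /= Hy; apply: valid_grows g _; apply: (H3 b); move: Hy.
  by rewrite /upd; have [->|//] := eqVneq b i; rewrite Ei inE orbC => ->.
- by move=> a b y /H4[Hy ->]; split=> //; apply: valid_grows g _.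
- move=> a b; have [r [r0]] := H5 a b; rewrite (pend_absorb _ _ Ei).
  have [Eb|nb] := eqVneq b i; last first.
    by rewrite andbF => Hr rb; exists r; rewrite /= /upd (negPf nb).
  subst b => Hr [rb|[_]]; last by lia.
  move: Hr; rewrite andbT; have [Ea|na] := eqVneq a (nm_sender x); last first.
    by move=> Hr; exists r; split=> //; left.
  subst a => /=; case Ed: (_ - r) => [//|d] [Es Hr].
  exists r.+1; split=> /=; first lia.
    by rewrite Hr; congr iota; lia.
  (* If [x] was one step ahead, the merged set is a closed entry of its sender, hence full. *)
  have [?|] := leqP r.+1 (stepc st i); [by left|move=> rlt; right].
  split; first lia.
  rewrite /upd !eqxx /merged Es; case: eqP => [|_]; first lia.
  rewrite rlt; apply: leq_trans (fsubset_leq_card (fsubsetUr _ _)).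
  by rewrite px Es; apply: H1; lia.
- move=> s C s1 C0 /= HC; have [j jC Hj] := H6 s C s1 C0 HC.
  exists j => // a aC; case: (Hj a aC) => [[p Hp]|].
    by left; exists p; apply: Rv_absorb.
  rewrite (pend_absorb _ _ Ei); case: andP => [[/eqP-> /eqP Ej]|_]; last by right.
  rewrite inE => /orP[/eqP Es|]; last by right.
  (* The message that leaves the pending list is of the current step, so its pair enters the
     entry. *)
  left; exists (nm_payload x); rewrite /= /upd -Ej eqxx HC // eqxx.
  by rewrite Ej /merged -Es -Ej HC // eqxx !inE eqxx orbT.
Qed.

(** * Returned values *)

Definition outval (R : nat -> {fset rpair n M}) k : {fset M} * {fset M} :=
  (tlcb_R (tlcr_result1 (R k.*2)) (R k.*2.+1), tlcb_B t_s (R k.*2.+1)).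

(** Call [k] has returned once step [k.*2.+1] is passed, or is current with the node idle; this is
    why [active] occurs in [nd_out]. Outputs thus become a function of [Rv]. *)
Record node_ok (ph : phase M) (sc : nat) (R : nat -> {fset rpair n M}) (nc : nat)
    (bc : nat -> option M) (o : nat -> option ({fset M} * {fset M})) : Prop := NodeOk {
  nd_phase : match ph with
    | Idle => sc = nc.*2.+1 /\ (nc = 0 \/ t_r <= #|` R sc|)
    | Round1 => 0 < nc /\ sc = nc.*2
    | Round2 X => [/\ 0 < nc, sc = nc.*2.+1 & X = tlcr_result1 (R nc.*2)]
    end;
  nd_bcast : forall k, isSome (bc k) = (0 < k <= nc);
  nd_out : forall k,
    o k = if (0 < k) && (k.*2.+1 + active ph <= sc) then Some (outval R k) else None;
  nd_open : active ph -> #|` R sc| < t_r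
}.

Definition node_inv st i : Prop :=
  node_ok (phase_of st i) (stepc st i) (Rv st i) (ncalls st i) (bcast st i) (out st i).

Definition inv st : Prop := net_inv st /\ forall i, node_inv st i.

Definition finish st i (X : {fset M}) (R' : {fset rpair n M}) : state n M :=
  State (crashed st) (upd (phase_of st) i Idle) (stepc st) (Rv st)
    (chan st) (inbox st) (ncalls st) (bcast st)
    (upd (out st) i (upd (out st i) (ncalls st i)
      (Some (tlcb_R X R', tlcb_B t_s R')))).

Lemma recv_stepE st i x rest :
  ~~ crashed st i -> active (phase_of st i) -> inbox st i = x :: rest ->
  recv_step t_r t_s st i =
  let st1 := absorb st i x rest in
  let R' := merged st i x in
  if #|` R'| < t_r then st1 else
  match phase_of st i with
  | Idle => st1
  | Round1 => tlcr_start st1 i (inr (tlcr_result1 R')) (Round2 (tlcr_result1 R'))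
  | Round2 X => finish st1 i X R'
  end.
Proof.
move=> /negPf nc act Ei; rewrite /recv_step nc Ei.
by case: (phase_of st i) act.
Qed.

Lemma recv_cases st i :
  recv_step t_r t_s st i = st \/
  [/\ ~~ crashed st i, active (phase_of st i) & exists x rest, inbox st i = x :: rest].
Proof.
rewrite /recv_step; case: (crashed st i); first by left.
case: (phase_of st i) => [||X]; first by left.
all: by case: (inbox st i) => [|x rest]; [left|right; split=> //; exists x, rest].
Qed.

Lemma upd_id (A : eqType) (B : Type) (h : A -> B) (u : A) (v : B) : upd h u v u = v.
Proof. by rewrite /upd eqxx. Qed.

Lemma upd_other (A : eqType) (B : Type) (h : A -> B) (u w : A) (v : B) :
  w != u -> upd h u v w = h w.
Proof. by rewrite /upd => /negPf->. Qed.

Lemma grows_step st e : inv st -> grows st (step t_r t_s st e).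
Proof.
case: e => [i m|a b|i|i|] [Hn Hd] //=; try exact: grows_refl.
- case: ifP => // _; case: (phase_of st i) => //.
  set st1 := State _ _ _ _ _ _ _ _ _.
  suff g : grows st st1 by apply: grows_trans g (grows_start _ _ _ _).
  split=> //= j k p E; rewrite /upd; have [Ej|//] := eqVneq j i; subst j.
  have [Ek|//] := eqVneq k _; subst k.
  by have := nd_bcast (Hd i) (ncalls st i).+1; rewrite E /=; lia.
- by case: (chan st a b).
- have [E'|[nc act [x [rest Ei]]]] := recv_cases st i; first by rewrite /= E'.
  have g := grows_absorb st i x rest.
  rewrite (recv_stepE nc act Ei) /=; case: ifP => // _.
  case: (phase_of st i) => [||X] //; last by case: g.
  exact: grows_trans g (grows_start _ _ _ _).
Qed.

(** A slot is written only at the end of [Round2], when [nd_out] shows it to be still empty. *)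
Lemma out_step st e i k v :
  inv st -> out st i k = Some v -> out (step t_r t_s st e) i k = Some v.
Proof.
case: e => [j m|a b|j|j|] [Hn Hd] //= E.
- by case: ifP => // _; case: (phase_of st j).
- by case: (chan st a b).
- have [E'|[nc act [x [rest Ei]]]] := recv_cases st j; first by rewrite /= E'.
  rewrite (recv_stepE nc act Ei) /=; case: ifP => // _.
  case Eph: (phase_of st j) => [||X] //=.
  have [Eij|ne] := eqVneq i j; last by rewrite upd_other.
  subst j; rewrite upd_id; have [Ek|ne] := eqVneq k (ncalls st i).
    have [] := Hd i; rewrite Eph => -[_ Esc _] _ Ho _.
    by move: E; rewrite Ho Ek Esc /=; case: ifP => //; lia.
  by rewrite upd_other.
Qed.

Lemma crashed_step st e i : crashed st i ->
  crashed (step t_r t_s st e) i /\ stepc (step t_r t_s st e) i = stepc st i.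
Proof.
case: e => [j m|a b|j|j|] cr //=.
- case: ifP => // ncr; case: (phase_of st j) => //=; split=> //.
  by rewrite upd_other //; apply: contraFneq ncr => <-.
- by case: (chan st a b).
- have [E'|[nc act [x [rest Ei]]]] := recv_cases st j; first by rewrite /= E'.
  have ne : i != j by apply: contraNneq nc => <-.
  rewrite (recv_stepE nc act Ei) /=; case: ifP => // _.
  by case: (phase_of st j) => //= *; rewrite upd_other.
- by rewrite /upd cr if_same.
Qed.

Lemma quorum st i s : inv st -> 1 < s ->
  s + active (phase_of st i) <= stepc st i -> t_r <= #|` Rv st i s|.
Proof.
move=> [Hn Hd] s1 le; have [lt|ge] := ltnP s (stepc st i).
  by apply: (ni_quorum Hn); rewrite s1.
have Es : s = stepc st i by lia.
have := nd_phase (Hd i); case: (phase_of st i) le => //=; try lia.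
by rewrite -Es => _ [Esc [nc0|//]]; lia.
Qed.

Lemma mem_result1 (Rs : {fset rpair n M}) (m : M) :
  m \in tlcr_result1 Rs <-> exists j, (j, inl m) \in Rs.
Proof.
rewrite /tlcr_result1 in_fset /= mem_pmap; split.
  by case/mapP => -[j [m'|//]] Hq [->]; exists j.
by case=> j Hj; apply/mapP; exists (j, inl m).
Qed.

Lemma mem_sets (Rs : {fset rpair n M}) (m : M) :
  m \in (\bigcup_(X <- pmap (fun q : rpair n M => getr q.2) Rs) X)%fset <->
  exists j X, (j, inr X) \in Rs /\ m \in X.
Proof.
split.
  case/bigfcupP => X; rewrite andbT mem_pmap => /mapP[[j [//|Y]] Hq [->]] Hm.
  by exists j, Y.
case=> j [X [Hq Hm]]; apply/bigfcupP; exists X => //.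
by rewrite andbT mem_pmap; apply/mapP; exists (j, inr X).
Qed.

Lemma sent_even st j k (p : payload M) : sent st k.*2 (j, p) ->
  exists2 m, bcast st j k = Some m & p = inl m.
Proof.
case=> /= _; rewrite /payload_at odd_double doubleK.
by case: (bcast st j k) => [m|] //= [<-]; exists m.
Qed.

Lemma sent_odd st j k (p : payload M) : sent st k.*2.+1 (j, p) ->
  [/\ 0 < k, k.*2 < stepc st j & p = inr (tlcr_result1 (Rv st j k.*2))].
Proof.
case=> /= /andP[k1 lt]; rewrite /payload_at /= odd_double /= => -[<-].
by split=> //; lia.
Qed.

Definition senders (s : seq (rpair n M)) : {set 'I_n} := [set j in map fst s].

(** One payload per node and step makes [fst] injective on the pairs sent in step [k]. *)
Lemma card_senders st k (s : seq (rpair n M)) : uniq s ->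
  (forall q, q \in s -> sent st k q) -> #|senders s| = size s.
Proof.
move=> us Hs; rewrite cardsE -(size_map fst); apply/card_uniqP.
rewrite map_inj_in_uniq // => -[j p] [j' p'] /Hs[_ /= E] /Hs[_ /= E'] /= Ej.
by subst j'; move: E; rewrite E' => -[->].
Qed.

(** The witness for both node sets of the specification. Nodes are selected by the value they
    broadcast, so all known senders of equal messages are included. *)
Definition senders_of st k (X : {fset M}) : {set 'I_n} :=
  [set j | if bcast st j k is Some m then m \in X else false].

Section Returned.

Context (st : state n M) (i : 'I_n) (k : nat) (R B : {fset M}).
Context (Hst : inv st) (Hout : out st i k = Some (R, B)).

Let Rs := Rv st i k.*2.+1.

Lemma returned_val : [/\ 0 < k, k.*2.+1 + active (phase_of st i) <= stepc st i,
  R = tlcb_R (tlcr_result1 (Rv st i k.*2)) Rs & B = tlcb_B t_s Rs].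
Proof.
have [_ Hd] := Hst; have := nd_out (Hd i) k; rewrite Hout.
by case: ifP => // /andP[k0 le] [-> ->].
Qed.

Lemma returned_set j X : (j, inr X) \in Rs ->
  k.*2 < stepc st j /\ X = tlcr_result1 (Rv st j k.*2).
Proof.
by case: Hst => Hn _ /(ni_sent Hn)/sent_odd[_ lt [->]].
Qed.

Lemma result1_bcast j m : m \in tlcr_result1 (Rv st j k.*2) ->
  exists j', bcast st j' k = Some m.
Proof.
case: Hst => Hn _ /mem_result1[j' /(ni_sent Hn)/sent_even[m' E [->]]].
by exists j'.
Qed.

Lemma returned_R_bcast m : m \in R -> exists j, bcast st j k = Some m.
Proof.
have [_ _ -> _] := returned_val; rewrite in_fsetU => /orP[/result1_bcast//|].
by case/mem_sets => j [X [/returned_set[_ ->] /result1_bcast]].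
Qed.

Lemma returned_BR : {subset B <= R}.
Proof.
have [_ _ -> ->] := returned_val => m; rewrite in_fset /= inE => /andP[Hm _].
by rewrite in_fsetU Hm orbT.
Qed.

(** The first-round entry alone contributes [t_r] distinct senders. *)
Lemma card_senders_R : t_r <= #|senders_of st k R|.
Proof.
have [k0 le ER _] := returned_val; have [Hn _] := Hst.
apply: leq_trans (_ : #|senders (Rv st i k.*2)| <= _).
  rewrite (card_senders (st := st) (k := k.*2)) ?fset_uniq //; last exact: ni_sent.
  by apply: quorum Hst _ _; lia.
apply: subset_leq_card; apply/subsetP => j; rewrite !inE.
case/mapP => -[j' p] Hq /= ->; have [m -> Ep] := sent_even (ni_sent Hn Hq).
by rewrite ER in_fsetU; apply/orP; left; apply/mem_result1; exists j'; rewrite -Ep.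
Qed.

(** Each sender occurs once in [Rs], with its own first-round result as payload, so counting pairs
    is counting nodes. *)
Lemma card_containing m :
  nsets_containing Rs m =
  #|[set a in senders Rs | m \in tlcr_result1 (Rv st a k.*2)]|.
Proof.
have [Hn _] := Hst; rewrite /nsets_containing -size_filter.
rewrite -(card_senders (st := st) (k := k.*2.+1)); first last.
- by move=> q; rewrite mem_filter => /andP[_]; apply: ni_sent.
- by rewrite filter_uniq ?fset_uniq.
apply: eq_card => a; rewrite !in_set; apply/mapP/andP.
  case=> -[a' [m'|X]]; rewrite mem_filter //= => /andP[Hm Hq] /= ->.
  by have [_ <-] := returned_set Hq; split=> //; apply/mapP; exists (a', inr X).
case=> /mapP[[a' p] Hq /= ->]; have [_ _ /= Ep] := sent_odd (ni_sent Hn Hq).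
by move=> Hm; exists (a', p) => //; rewrite mem_filter Ep /= Hm -Ep.
Qed.

(** Double counting, with the second-round senders as [S], the first-round senders known to [a] as
    [D a], and the nodes whose message is not in [B] as [W]. *)
Lemma card_senders_B : 0 < t_s <= t_r ->
  #|~: senders_of st k B| * (t_r - t_s).+1 <= t_r * (n - t_r).
Proof.
move=> ts; have [k0 le _ EB] := returned_val; have [Hn _] := Hst.
have := @double_counting _ (senders Rs) (~: senders_of st k B)
  (fun a => senders (Rv st a k.*2)) t_r t_s ts; rewrite card_ord; apply.
- rewrite (card_senders (st := st) (k := k.*2.+1)) ?fset_uniq //; last exact: ni_sent.
  by apply: quorum Hst _ _; lia.
- move=> a; rewrite in_set => /mapP[[a' p] Hq /= ->].
  rewrite (card_senders (st := st) (k := k.*2)) ?fset_uniq //; last exact: ni_sent.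
  have [_ lt _] := sent_odd (ni_sent Hn Hq); apply: (ni_quorum Hn); lia.
move=> j jW; set A := [set _ in _ | _].
(* A node that has not broadcast also lies in [W]; it is covered by the empty case, where [0 < t_s]
   suffices. *)
have [->|/set0Pn[a]] := eqVneq A set0; first by rewrite cards0; case/andP: ts.
rewrite in_set => /andP[aS]; rewrite in_set => /mapP[[j' p] Hq /= Ej]; subst j'.
have [m Ebc Ep] := sent_even (ni_sent Hn Hq).
(* The inclusion can be strict, since other nodes may have broadcast the same [m]. *)
have sub : A \subset [set a in senders Rs | m \in tlcr_result1 (Rv st a k.*2)].
  apply/subsetP => b; rewrite /A !in_set => /andP[bS /mapP[[j' p'] Hq'] /= Ej].
  subst j'; have [m' Ebc' Ep'] := sent_even (ni_sent Hn Hq').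
  rewrite bS; apply/mem_result1; exists j; move: Ebc; rewrite Ebc' => -[<-].
  by rewrite -Ep'.
apply: leq_ltn_trans (subset_leq_card sub) _; rewrite -card_containing.
move: jW; rewrite in_setC in_set Ebc EB ltnNge; apply: contraNN => ge.
rewrite in_fset /= inE ge andbT; apply/mem_sets.
move: aS; rewrite in_set => /mapP[[a' p'] Hq' /= Ea]; subst a'.
have [_ _ Ep'] := sent_odd (ni_sent Hn Hq').
exists a, (tlcr_result1 (Rv st a k.*2)); rewrite -Ep'; split=> //.
by apply/mem_result1; exists j; rewrite -Ep.
Qed.

End Returned.

(** * Liveness *)

(** Only a call of its own advances an idle live node, and such a call always does. *)
Lemma idle_step st e i : ~~ crashed st i -> phase_of st i = Idle ->
  stepc st i < stepc (step t_r t_s st e) i \/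
  [/\ phase_of (step t_r t_s st e) i = Idle,
      stepc (step t_r t_s st e) i = stepc st i & forall m, e <> Call i m].
Proof.
move=> nc idle; case: e => [j m|a b|j|j|] /=; try by right.
- have [Eij|ne] := eqVneq j i.
    by subst j; left; rewrite (negPf nc) idle /= upd_id.
  right; split; last by move=> m' [E]; rewrite E eqxx in ne.
    case: ifP => // _; case: (phase_of st j) => //=.
    by rewrite upd_other // eq_sym.
  case: ifP => // _; case: (phase_of st j) => //=.
  by rewrite upd_other // eq_sym.
- by right; case: (chan st a b).
- right; rewrite /recv_step.
  have [Eij|ne] := eqVneq j i; first by subst j; rewrite (negPf nc) idle.
  case: ifP => // _; case: (phase_of st j) => //; case: (inbox st j) => // x l.
    by case: ifP => //= _; rewrite !upd_other // eq_sym.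
  by move=> l'; case: ifP => //= _; rewrite upd_other // eq_sym.
Qed.

Definition pending st a b s : bool := s \in map (@nm_step n M) (pend st a b).

Lemma pending_start st i p ph a b s : s <= stepc st a ->
  pending (tlcr_start st i p ph) a b s = pending st a b s.
Proof.
move=> le; rewrite /pending pend_start; case: eqP => // E; subst i.
by rewrite map_rcons mem_rcons inE /=; case: eqP => //; lia.
Qed.

Lemma pending_recv st i x rest a b s :
  ~~ crashed st i -> active (phase_of st i) -> inbox st i = x :: rest ->
  s <= stepc st a ->
  pending (step t_r t_s st (Recv i)) a b s = pending (absorb st i x rest) a b s.
Proof.
move=> nc act Ei le; rewrite /= (recv_stepE nc act Ei) /=; case: ifP => // _.
by case: (phase_of st i) => // *; rewrite pending_start.
Qed.

(** A node at step [s] or beyond sends no further step-[s] message, so pending ones can only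
    disappear. *)
Lemma pending_step st e a b s : inv st -> s <= stepc st a ->
  pending (step t_r t_s st e) a b s -> pending st a b s.
Proof.
move=> [Hn _] le; case: e => [i m|c d|i|i|] //.
- rewrite /=; case: ifP => // _; case: (phase_of st i) => //.
  by rewrite pending_start.
- case Ec: (chan st c d) => [|x rest]; first by rewrite /= Ec.
  rewrite /pending (pend_deliver _ _ Ec) //.
  by apply: (proj2 (ni_chan Hn (a := c) (b := d) _)); rewrite Ec mem_head.
- have [E'|[nc act [x [rest Ei]]]] := recv_cases st i; first by rewrite /= E'.
  rewrite (pending_recv _ nc act Ei) // /pending (pend_absorb _ _ Ei).
  by case: ifP => // _ H; rewrite inE H orbT.
Qed.

(** Pending step numbers are distinct, so receiving [x] removes the only occurrence of its
    number. *)
Lemma not_pending_recv st x rest b :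
  inv st -> ~~ crashed st b -> active (phase_of st b) -> inbox st b = x :: rest ->
  ~~ pending (step t_r t_s st (Recv b)) (nm_sender x) b (nm_step x).
Proof.
move=> [Hn _] nc act Ei.
have [[/= /andP[_ le] _] _] : valid_msg st x.
  by apply: (ni_inbox Hn (b := b)); rewrite Ei mem_head.
rewrite (pending_recv _ nc act Ei) //.
have [r [_ Hr _]] := ni_fifo Hn (nm_sender x) b.
have := iota_uniq r.+1 (stepc st (nm_sender x) - r).
by rewrite -Hr (pend_absorb _ _ Ei) !eqxx /= => /andP[].
Qed.

(** Apart from removals at the head, a queue changes only at its end. The position of a message can
    therefore serve as the measure in [leads_to]. *)
Lemma chan_step st e a b :
  e = Deliver a b /\
    (forall x rest, chan st a b = x :: rest ->
       chan (step t_r t_s st e) a b = rest /\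
       inbox (step t_r t_s st e) b = rcons (inbox st b) x) \/
  e <> Deliver a b /\ exists l, chan (step t_r t_s st e) a b = chan st a b ++ l.
Proof.
have same st' : chan st' a b = chan st a b -> exists l, chan st' a b = chan st a b ++ l.
  by move=> ->; exists [::]; rewrite cats0.
have start st' i p ph : chan st' a b = chan st a b ->
    exists l, chan (tlcr_start st' i p ph) a b = chan st a b ++ l.
  move=> E; rewrite /= E; case: ifP => _; last by exists [::]; rewrite cats0.
  by eexists; rewrite -cats1.
case: e => [i m|c d|i|i|] /=; try by right; split=> //; apply: same.
- right; split=> //; case: ifP => _; first exact: same.
  by case: (phase_of st i) => *; try exact: same; apply: start.
- have [[-> ->]|ne] := classic (c = a /\ d = b).
    by left; split=> // x rest ->; rewrite /= !eqxx upd_id.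
  right; split; first by case=> E1 E2; apply: ne.
  apply: same; case: (chan st c d) => //= x rest.
  by case: andP => // -[/eqP E1 /eqP E2]; case: ne.
- right; split=> //; rewrite /recv_step; case: ifP => _; first exact: same.
  case: (phase_of st i) => [||X]; first exact: same.
  all: case: (inbox st i) => [|x rest]; first exact: same.
  all: by case: ifP => _; try exact: same; apply: start.
Qed.

Lemma inbox_step st e b :
  e <> Recv b -> exists l, inbox (step t_r t_s st e) b = inbox st b ++ l.
Proof.
have same st' : inbox st' b = inbox st b -> exists l, inbox st' b = inbox st b ++ l.
  by move=> ->; exists [::]; rewrite cats0.
case: e => [i m|c d|i|i|] /= neb; try exact: same.
- by apply: same; case: ifP => // _; case: (phase_of st i).
- case: (chan st c d) => [|x rest] /=; first exact: same.
  rewrite /upd; case: eqP => [->|_]; last exact: same.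
  by eexists; rewrite -cats1.
- have ne : b != i by apply/eqP => E; apply: neb; rewrite E.
  apply: same; rewrite /recv_step; case: ifP => // _.
  case: (phase_of st i) => [||X] //.
  all: case: (inbox st i) => [|x rest] //.
  all: by case: ifP => _ /=; rewrite upd_other.
Qed.

Lemma inbox_recv st x rest b :
  ~~ crashed st b -> active (phase_of st b) -> inbox st b = x :: rest ->
  inbox (step t_r t_s st (Recv b)) b = rest.
Proof.
move=> nc act Ei; rewrite /= (recv_stepE nc act Ei) /=.
by case: ifP => _ /=; [|case: (phase_of st b) => *]; rewrite /= upd_id.
Qed.

Lemma crash_event st e i :
  ~~ crashed st i -> crashed (step t_r t_s st e) i -> e = Crash i.
Proof.
move=> nc; case: e => [j m|a b|j|j|] /=; try by rewrite (negPf nc).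
- by case: ifP => _; [|case: (phase_of st j) => [||X]]; rewrite /= (negPf nc).
- by case: (chan st a b) => [|x rest]; rewrite /= (negPf nc).
- have [->|[ncj act [x [rest Ei]]]] := recv_cases st j; first by rewrite (negPf nc).
  rewrite (recv_stepE ncj act Ei) /=; case: ifP => _ /=; first by rewrite (negPf nc).
  by case: (phase_of st j) => [||X]; rewrite /= (negPf nc).
- by rewrite /upd; case: eqP => [->|_]; rewrite ?(negPf nc).
Qed.

Lemma run_prefix (ev ev' : nat -> event n M) t :
  (forall u, u < t -> ev' u = ev u) -> run t_r t_s ev' t = run t_r t_s ev t.
Proof.
elim: t => // t IH Heq /=; rewrite Heq // IH // => u lt.
by apply: Heq; apply: ltnW.
Qed.

(** * Preservation of the full invariant *)

Context (t_r_gt0 : 0 < t_r).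

Lemma inv_init : inv (init_state n M).
Proof.
split; first exact: net_init.
by move=> i; split=> //= [|k|k]; [split=> //; left|lia|case: ifP => //; lia].
Qed.

Lemma inv_call st i m : inv st -> inv (step t_r t_s st (Call i m)).
Proof.
move=> Hst /=; case: ifP => // _; case Eph: (phase_of st i) => //.
have [Hn Hd] := Hst; have [] := Hd i; rewrite Eph => -[Esc Hq] Hb Ho _.
set st1 := State _ _ _ _ _ _ _ _ _.
split.
  apply: net_start => /=.
  - apply: net_bookkeeping => // j k p E; rewrite /upd.
    have [Ej|//] := eqVneq j i; subst j.
    have [Ek|//] := eqVneq k _; subst k.
    by have := Hb (ncalls st i).+1; rewrite E /=; lia.
  - by rewrite Esc.
  - by case: Hq => [H0|]; [left; rewrite Esc H0|right].
  - have -> : (stepc st i).+1 = (ncalls st i).+1.*2 by rewrite Esc doubleS.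
    by rewrite /payload_at odd_double doubleK /= !upd_id.
move=> j; have [->|ne] := eqVneq j i; last first.
  by rewrite /node_inv /= !(upd_other _ _ ne); apply: Hd.
rewrite /node_inv /= !upd_id; split=> //=.
- by rewrite Esc doubleS.
- by move=> k; rewrite /upd; have [->|] := eqVneq k _; rewrite ?Hb /=; lia.
- move=> k; rewrite Ho /= Esc.
  have -> : (k.*2.+1 + 1 <= (ncalls st i).*2.+2) = (k.*2.+1 + 0 <= (ncalls st i).*2.+1).
    lia.
  case: ifP => // /andP[_ le]; congr Some.
  by rewrite /outval !upd_other //; apply/eqP; lia.
(* A fresh entry is empty, and [0 < t_r] keeps its loop open. *)
- by rewrite upd_id cardfs0.
Qed.

Lemma inv_recv st i : inv st -> inv (step t_r t_s st (Recv i)).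
Proof.
move=> Hst /=; have [->//|[nc act [x [rest Ei]]]] := recv_cases st i.
rewrite (recv_stepE nc act Ei) /=.
case Eph: (phase_of st i) => [||X]; first by rewrite Eph in act.
all: have [Hn Hd] := Hst.
all: have [] := Hd i; rewrite Eph /= => Hp Hb Ho /(_ isT) Hlt.
all: have Hn1 : net_inv (absorb st i x rest)
  by apply: net_absorb => //; case: Hp; lia.
all: have nd1 j : j != i -> node_inv (absorb st i x rest) j
  by move=> ne; rewrite /node_inv /= !(upd_other _ _ ne); apply: Hd.
(* Four cases follow: [Round1] and then [Round2], each with the entry still short and then full. *)
all: have [lt|ge] := ltnP.
- split=> // j; have [->|/nd1//] := eqVneq j i.
  rewrite /node_inv /= Eph upd_id; split=> //=; last by rewrite upd_id.
  move=> k; rewrite Ho; case: ifP => // /andP[_ le]; congr Some.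
  by rewrite /outval !upd_other //; apply/eqP; lia.
- split.
    apply: net_start => //=; first lia.
    + by right; rewrite !upd_id.
    + by rewrite /payload_at /=; case: Hp => _ ->; rewrite odd_double /= !upd_id.
  move=> j; have [->|ne] := eqVneq j i; last first.
    by have := nd1 j ne; rewrite /node_inv /= !(upd_other _ _ ne).
  rewrite /node_inv /= !upd_id; case: Hp => nc0 Esc; split=> //=.
  + by split=> //; rewrite ?Esc // upd_other ?upd_id //; apply/eqP; lia.
  + move=> k; rewrite Ho Esc.
    have -> : (k.*2.+1 + 1 <= (ncalls st i).*2.+1) = (k.*2.+1 + 1 <= (ncalls st i).*2).
      lia.
    case: ifP => // /andP[_ le]; congr Some.
    by rewrite /outval !upd_other //; apply/eqP; lia.
  + by rewrite upd_id cardfs0.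
- split=> // j; have [->|/nd1//] := eqVneq j i.
  case: Hp => nc0 Esc EX; rewrite /node_inv /= Eph upd_id; split=> //=.
  + by split=> //; rewrite upd_other //; apply/eqP; lia.
  + move=> k; rewrite Ho; case: ifP => // /andP[_ le]; congr Some.
    by rewrite /outval !upd_other //; apply/eqP; lia.
  + by rewrite upd_id.
- split; first exact: net_bookkeeping.
  move=> j; have [->|ne] := eqVneq j i; last first.
    by have := nd1 j ne; rewrite /node_inv /= !(upd_other _ _ ne).
  case: Hp => nc0 Esc EX; rewrite /node_inv /= !upd_id; split=> //=.
  + by split=> //; right; rewrite upd_id.
  + move=> k; have [->|ne] := eqVneq k (ncalls st i).
      rewrite upd_id nc0 Esc /= addn0 leqnn /outval upd_id EX upd_other //.
      by apply/eqP; lia.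
    (* The two bounds differ only at [k = ncalls st i], which is excluded here. *)
    rewrite (upd_other _ _ ne) Ho; have -> : (k.*2.+1 + 1 <= stepc st i) = (k.*2.+1 + 0 <= stepc st i).
      by rewrite Esc; lia.
    case: ifP => // /andP[_ le]; congr Some.
    by rewrite /outval Esc !upd_other //; apply/eqP; lia.
Qed.

Lemma inv_step st e : inv st -> inv (step t_r t_s st e).
Proof.
case: e => [i m|a b|i|i|] Hst //; first exact: inv_call; last 1 first.
- by case: Hst => Hn Hd; split=> //; apply: net_bookkeeping.
- case: Hst => Hn Hd; split; first exact: net_deliver.
  by move=> i; have := Hd i; rewrite /node_inv /=; case: (chan st a b).
- exact: inv_recv.
Qed.

Lemma inv_run ev t : inv (run t_r t_s ev t).
Proof. by elim: t => [|t IH] /=; [apply: inv_init|apply: inv_step]. Qed.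

(** * Monotonicity along a run *)

Section Run.

Context (ev : nat -> event n M).
Local Notation run := (run t_r t_s ev).

Lemma grows_run t t' : t <= t' -> grows (run t) (run t').
Proof.
move/subnK <-; elim: (t' - t) => [|d IH]; first exact: grows_refl.
exact: grows_trans IH (grows_step _ (inv_run _ _)).
Qed.

Lemma out_run t t' i k v : t <= t' -> out (run t) i k = Some v -> out (run t') i k = Some v.
Proof.
move/subnK <-; elim: (t' - t) => [//|d IH] /IH.
exact/out_step/inv_run.
Qed.

Lemma crashed_run t t' i : t <= t' -> crashed (run t) i ->
  crashed (run t') i /\ stepc (run t') i = stepc (run t) i.
Proof.
move/subnK <-; elim: (t' - t) => [//|d IH] /IH[cr <-].
exact: crashed_step.
Qed.

Lemma pending_run t t' a b s : t <= t' -> s <= stepc (run t) a ->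
  ~~ pending (run t) a b s -> ~~ pending (run t') a b s.
Proof.
move/subnK <-; elim: (t' - t) => [//|d IH] le /(IH le); apply: contraNN.
apply: pending_step (inv_run _ _) _; apply: leq_trans le _.
exact/grows_stepc/grows_run/leq_addl.
Qed.

Lemma returned_result1 t t' i k m R B :
  k.*2 < stepc (run t) i -> m \in tlcr_result1 (Rv (run t) i k.*2) ->
  out (run t') i k = Some (R, B) -> m \in R.
Proof.
move=> lt Hm /(out_run (leq_maxr t t')) Hout.
have [_ _ -> _] := returned_val (inv_run _ _) Hout.
by rewrite in_fsetU (grows_Rv (grows_run (leq_maxl t t'))) // Hm.
Qed.

(** A recorded broadcast never changes, so the values visible at time [t] settle [broadcast_in] for
    these nodes. *)
Lemma exactly_from_senders t k X :
  (forall m, m \in X -> exists j, bcast (run t) j k = Some m) ->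
  exactly_from t_r t_s ev (senders_of (run t) k X) k X.
Proof.
move=> HX; split=> [j|m].
  by rewrite in_set; case E: (bcast _ _ _) => [m|] // _; exists m, t.
split=> [mX|[j]].
  by have [j E] := HX m mX; exists j; [rewrite in_set E|exists t].
rewrite in_set; case E: (bcast _ _ _) => [m'|] // mX [t' E'].
have := grows_bcast (grows_run (leq_maxl t t')) E.
by rewrite (grows_bcast (grows_run (leq_maxr t t')) E') => -[->].
Qed.

End Run.

(** * Progress of correct nodes in admissible runs *)

Section Liveness.

Context (ev : nat -> event n M) (f : nat).
Local Notation run := (run t_r t_s ev).
Context (n_f : t_r <= n - f) (adm : admissible t_r t_s f ev).

Let correct i := forall t, ~~ crashed (run t) i.

Lemma idle_progress i t : correct i -> phase_of (run t) i = Idle ->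
  exists2 t', t <= t' & stepc (run t) i < stepc (run t') i.
Proof.
move=> Hi idle.
pose P t' := phase_of (run t') i = Idle /\ stepc (run t') i = stepc (run t) i.
apply: (@leads_to P _ (fun t' => exists m, ev t' = Call i m) (fun => 0)) => //.
  case: adm => _ _ _ Hcall u; have [t' le [H|]] := Hcall i u; first by exists t'.
  by rewrite (negPf (Hi t')).
move=> u [idle_u Eu]; have /= [lt|[H1 H2 H3]] := idle_step (ev u) (Hi u) idle_u.
  by left; rewrite /= -Eu.
by right; split=> //; [split; rewrite // H2|case=> m /H3].
Qed.

(** Every idle period ends with an increase of the step counter, so a bounded counter allows only
    finitely many. *)
Lemma eventually_active i v : correct i -> (forall t, stepc (run t) i <= v) ->
  exists t, forall t', t <= t' -> active (phase_of (run t') i).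
Proof.
move=> Hi Hv; suff H u t : v - stepc (run t) i < u ->
    exists t, forall t', t <= t' -> active (phase_of (run t') i).
  exact: H _ 0 (leqnn _).
elim: u t => // u IH t lt.
have [[t' tt' idle]|no_idle] :=
  classic (exists2 t', t <= t' & phase_of (run t') i = Idle).
  have [t'' t't'' lt'] := idle_progress Hi idle; apply: (IH t'').
  by have := grows_stepc (grows_run ev tt') i; have := Hv t''; lia.
exists t => t' tt'; case E: (phase_of _ _) => //.
by case: no_idle; exists t'.
Qed.

Lemma delivered a b s t : correct b ->
  has (fun x => nm_step x == s) (chan (run t) a b) ->
  exists2 t', t <= t' &
    has (fun x => (nm_sender x == a) && (nm_step x == s)) (inbox (run t') b).
Proof.
set p := fun x => _ == s => Hb.
apply: (@leads_to (fun t => has p (chan (run t) a b)) _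
  (fun t => ev t = Deliver a b) (fun t => find p (chan (run t) a b))).
  case: adm => _ Hdel _ _ u; have [t' le [H|]] := Hdel a b u; first by exists t'.
  by rewrite (negPf (Hb t')).
move=> {}t; have [Hn _] := inv_run ev t.
case: (chan_step (run t) (ev t) a b) => [[_ Hch]|[ne [l Hch]]] Hp; last first.
  by right; rewrite /= Hch has_cat find_cat Hp.
case Ec: (chan (run t) a b) Hp => [//|x rest] /=.
have [H1 H2] := Hch _ _ Ec; rewrite H1 H2 has_rcons.
have -> : nm_sender x == a.
  by apply/eqP/(proj2 (ni_chan Hn (a := a) (b := b) _)); rewrite Ec mem_head.
by rewrite -/(p x); case: (p x) => /= Hp; [left|right].
Qed.

(** A correct node with bounded counter is eventually always in a loop and keeps receiving. A
    pending message first moves up the channel, then up the inbox. *)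
Lemma drain b v : correct b -> (forall t, stepc (run t) b <= v) ->
  forall a s t, s <= stepc (run t) a ->
  exists2 t', t <= t' & ~~ pending (run t') a b s.
Proof.
move=> Hb Hv a s t le; have [t0 Hact] := eventually_active Hb Hv.
wlog t0t : t le / t0 <= t => [H|].
  have [||t' le' Hp] := H (maxn t t0); last by exists t' => //; lia.
    by apply: leq_trans le (grows_stepc (grows_run ev (leq_maxl t t0)) a).
  exact: leq_maxr.
have [pd|npd] := boolP (pending (run t) a b s); last by exists t.
pose p x := (nm_sender x == a) && (nm_step x == s).
have [t1 tt1 Hp] : exists2 t1, t <= t1 & has p (inbox (run t1) b).
  have : has p (inbox (run t) b) || has (fun x => nm_step x == s) (chan (run t) a b).
    move: pd => /mapP[x]; rewrite mem_cat mem_filter => /orP[/andP[xa xi]|xc] Es.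
      by apply/orP; left; apply/hasP; exists x; rewrite // /p xa Es eqxx.
    by apply/orP; right; apply/hasP; exists x; rewrite // Es.
  by case/orP => [Hp|]; [exists t|apply: delivered].
pose P u := [/\ t0 <= u, s <= stepc (run u) a & has p (inbox (run u) b)].
have [|||u t1u Hu] := @leads_to P (fun u => ~~ pending (run u) a b s)
    (fun u => ev u = Recv b) (fun u => find p (inbox (run u) b)) _ _ t1.
- case: adm => _ _ Hrecv _ u; have [t' le' [H|]] := Hrecv b u; first by exists t'.
  by rewrite (negPf (Hb t')).
- move=> u [t0u le_u Hpu].
  have le_u1 : s <= stepc (run u.+1) a.
    by apply: leq_trans le_u (grows_stepc (grows_run ev (leqnSn u)) a).
  have [Ee|ne] := classic (ev u = Recv b); last first.
    have [l Hl] := inbox_step (run u) ne.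
    by right; split=> //; [split=> //; first lia|]; rewrite /= Hl ?has_cat ?find_cat Hpu.
  case Ei: (inbox (run u) b) Hpu => [//|x rest] /=; rewrite Ee.
  rewrite (inbox_recv (Hb u) (Hact u t0u) Ei).
  case px: (p x) => /= Hp'; [left|right].
    case/andP: px => /eqP <- /eqP <-.
    exact: not_pending_recv (inv_run ev u) (Hb u) (Hact u t0u) Ei.
  split=> //; split=> //; first lia.
  by rewrite /= Ee (inbox_recv (Hb u) (Hact u t0u) Ei).
- split=> //; first lia.
  by apply: leq_trans le (grows_stepc (grows_run ev tt1) a).
by exists u => //; lia.
Qed.

(** If [b] stayed at or below step [s], it would still receive the step-[s.+1] message of [a], and
    by [ni_fifo] its entry would be full while its loop is open. *)
Lemma advance a b s t : correct b -> s < stepc (run t) a ->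
  exists t', s < stepc (run t') b.
Proof.
move=> Hb lt; apply: NNPP => H.
have Hv t' : stepc (run t') b <= s.
  by rewrite leqNgt; apply/negP => lt'; apply: H; exists t'.
have [t0 Hact] := eventually_active Hb Hv.
have lt_max := leq_trans lt (grows_stepc (grows_run ev (leq_maxl t t0)) a).
have [u le Hu] := drain Hb Hv lt_max.
have [Hn Hd] := inv_run ev u.
have [r [r0 Hr rb]] := ni_fifo Hn a b.
have := leq_trans lt_max (grows_stepc (grows_run ev le) a) => lt_u.
move: Hu; rewrite /pending Hr mem_iota => Hu.
have := nd_open (Hd b) (Hact u (leq_trans (leq_maxr t t0) le)).
by have := Hv u; lia.
Qed.

(** By induction on [s]: if [i] never passes [s], all correct nodes end up waiting in step [s] with
    all its messages consumed, and the first of them to arrive holds a full entry. *)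
Lemma reaches s i : correct i -> exists t, s <= stepc (run t) i.
Proof.
elim: s i => [|s IH] i Hi; first by exists 0.
apply: NNPP => H.
(* Any node beyond [s], even a failing one, would pull [i] along. *)
have Hs a t : stepc (run t) a <= s.
  rewrite leqNgt; apply/negP => lt; apply: H.
  by have [t' Ht'] := advance Hi lt; exists t'.
(* After [T1] all failing nodes have crashed, so the live nodes [C] at time [T] are exactly the
   correct ones. *)
have [T1 HT1] : exists t, forall t', t <= t' -> forall j,
    correct j \/ crashed (run t') j.
  apply: eventually_all => j; have [Hj|/not_all_ex_not[t Ht]] := classic (correct j).
    by exists 0 => t' _; left.
  exists t => t' le; right; move/negP/negPn: Ht => Ht.
  by have [] := crashed_run le Ht.
have [T2 HT2] : exists t, forall t', t <= t' -> forall j,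
    correct j -> active (phase_of (run t') j) /\ stepc (run t') j = s.
  apply: eventually_all => j; have [Hj|nj] := classic (correct j); last by exists 0.
  have [t Ht] := IH j Hj; have [t0 Ht0] := eventually_active Hj (Hs j).
  exists (maxn t t0) => t' le _; split; first by apply: Ht0; lia.
  apply/eqP; rewrite eqn_leq Hs /=; apply: leq_trans Ht (grows_stepc (grows_run ev _) j).
  lia.
have [T3 HT3] : exists t, forall t', t <= t' -> forall ji : 'I_n * 'I_n,
    correct ji.1 -> correct ji.2 -> ~~ pending (run t') ji.1 ji.2 s.
  apply: eventually_all => -[j k] /=.
  have [Hj|nj] := classic (correct j); last by exists 0.
  have [Hk|nk] := classic (correct k); last by exists 0.
  have [t Ht] := IH j Hj; have [t0 le0 Ht0] := drain Hk (Hs k) Ht.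
  exists t0 => t' le _ _; apply: pending_run le _ Ht0.
  exact: leq_trans Ht (grows_stepc (grows_run ev le0) j).
pose T := maxn T1 (maxn T2 T3).
have [T1T T2T T3T] : [/\ T1 <= T, T2 <= T & T3 <= T] by rewrite /T; split; lia.
pose C := [set j | ~~ crashed (run T) j].
have [Hn Hd] := inv_run ev T.
have C_ge : t_r <= #|C|.
  have -> : C = ~: [set j | crashed (run T) j] by apply/setP => j; rewrite !in_set.
  have [Hf _ _ _] := adm; have := Hf T; have := cardsC [set j | crashed (run T) j].
  by rewrite card_ord; lia.
have CP j : j \in C -> [/\ correct j, active (phase_of (run T) j) & stepc (run T) j = s].
  rewrite in_set => nc; have [Hj|cr] := HT1 T T1T j; last by rewrite cr in nc.
  by have [] := HT2 T T2T j Hj.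
(* An active node has made a call, so it is at step 2 or later. *)
have s1 : 1 < s.
  have [|_ act <-] := CP i; first by rewrite in_set.
  by have := nd_phase (Hd i); case: (phase_of (run T) i) act => //= [_ []|X _ []]; lia.
have [||j jC Hj] := ni_kept Hn s1 (C := C).
- by rewrite -card_gt0; apply: leq_trans C_ge.
- by move=> j /CP[].
have [corj actj stepj] := CP j jC.
have := nd_open (Hd j) actj; rewrite stepj ltnNge => /negP; apply.
apply: leq_trans C_ge _.
rewrite -(card_senders (st := run T) (k := s)) ?fset_uniq //; last exact: ni_sent.
apply: subset_leq_card; apply/subsetP => a aC; rewrite in_set.
have [[p Hp]|pd] := Hj a aC; first by apply/mapP; exists (a, p).
have [cora _ _] := CP a aC; have := HT3 T T3T (a, j) cora corj.
by rewrite /pending pd.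
Qed.

Lemma correct_returns i k : correct i -> 0 < k ->
  exists R B, returned t_r t_s ev i k R B.
Proof.
(* Step [k.*2.+2] lies beyond both rounds of call [k], so the call has returned whatever the
   phase. *)
move=> Hi k0; have [t Ht] := reaches k.*2.+2 Hi; have [_ Hd] := inv_run ev t.
do 2!eexists; exists t; rewrite (nd_out (Hd i) k) k0 /= ifT //.
by case: (active _); lia.
Qed.

(** The first-round result is final once step [k.*2] is passed and is contained in every later
    return value. For a failing node this was settled before its crash, hence in every run sharing
    that prefix. *)
Lemma result1_would_receive t i k m :
  0 < k -> k.*2 < stepc (run t) i -> m \in tlcr_result1 (Rv (run t) i k.*2) ->
  would_receive t_r t_s f ev i k m.
Proof.
move=> k0 lt Hm; have [Hi|/not_all_ex_not Hcr] := classic (correct i).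
  left; have [R [B [t' Hout]]] := correct_returns Hi k0.
  by exists R, B; split; [exists t'|apply: returned_result1 lt Hm Hout].
have {Hcr} exT : exists T, crashed (run T) i.
  by case: Hcr => T /negP; rewrite negbK; exists T.
case: (ex_minnP exT) => -[//|T] crT minT.
have nc : ~~ crashed (run T) i by apply/negP => /minT; rewrite ltnn.
have Ecr : ev T = Crash i := crash_event nc crT.
(* A crashed node's counter is frozen, so step [k.*2] was already passed at time [T], even if [t] is
   later. *)
have ltT : k.*2 < stepc (run T) i.
  have [le|gt] := leqP t T; first exact: leq_trans lt (grows_stepc (grows_run ev le) i).
  by move: lt; rewrite (proj2 (crashed_run gt crT)) /= Ecr.
right; exists T; split=> // ev' _ Heq R B [t' Hout].
have E : Defs.run t_r t_s ev' T = run T by apply: run_prefix.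
apply: (@returned_result1 ev' T t' i k m R B) => //; rewrite E //.
have [le|/ltnW le] := leqP t T.
  by rewrite (grows_Rv (grows_run ev le)).
by rewrite -(grows_Rv (grows_run ev le)).
Qed.

End Liveness.

End Execution.

(** * The four properties of the broadcast abstraction *)

Theorem theorem3 (n f t_r t_s t_b : nat) (M : choiceType) :
  (0 < t_r)%N -> (t_r <= n - f)%N ->
  (0 < t_s)%N -> (t_s <= t_r)%N ->
  (0 < t_b)%N -> (t_b%:R <= n%:R - f_b n t_r t_s :> rat)%R ->
  forall ev : nat -> event n M,
    admissible t_r t_s f ev ->
    TSB t_r t_s f ev t_r t_b t_s.
Proof.
move=> r0 r_nf s0 sr _ b_le ev adm.
have Hinv t : inv t_r t_s (run t_r t_s ev t) by apply: inv_run.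
split.
- move=> i k m [t Hbc]; have [Hi|] := classic (fails t_r t_s ev i); [by right|left].
  have [_ Hd] := Hinv t; have := nd_bcast (Hd i) k; rewrite Hbc => /esym/andP[k0 _].
  apply: (correct_returns r0 r_nf adm) k0 => t'.
  by apply/negP => cr; case: b; exists t'.
- move=> i k R B [t Hout]; exists (senders_of (run t_r t_s ev t) k R).
  split; first exact: card_senders_R (Hinv t) Hout.
  by apply: exactly_from_senders => // m; apply: returned_R_bcast (Hinv t) Hout _.
- move=> i k R B [t Hout]; exists (senders_of (run t_r t_s ev t) k B); split.
    (* At most [f_b] nodes lie outside the witness, so it has at least [n - f_b >= t_b] elements. *)
    have := card_senders_B (Hinv t) Hout; rewrite s0 sr => /(_ isT).
    have := cardsC (senders_of (run t_r t_s ev t) k B); rewrite card_ord.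
    set w := #|~: _|; set v := #|_| => Evw w_le.
    have {}w_le := le_f_b _ w_le.
    rewrite -(ler_nat rat); apply: le_trans b_le _.
    by rewrite -Evw natrD lerBlDr lerD2l Evw w_le //; lia.
  apply: exactly_from_senders => // m mB.
  apply: (returned_R_bcast (Hinv t) Hout); exact: returned_BR (Hinv t) Hout _ mB.
move=> i k R B m [t Hout] mB; have [k0 _ _ EB] := returned_val (Hinv t) Hout.
set st := run t_r t_s ev t in Hout EB *.
(* The witnesses are the second-round senders whose set contains [m]; membership in [B] says that
   there are at least [t_s]. *)
exists [set a in senders (Rv st i k.*2.+1) | m \in tlcr_result1 (Rv st a k.*2)]; split.
  rewrite -(card_containing _ _ (Hinv t)).
  by move: mB; rewrite EB in_fset /= inE => /andP[].
move=> j; rewrite !in_set => /andP[/mapP[[j' p] Hq /= ->] Hm].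
have [Hn _] := Hinv t; have [_ lt _] := sent_odd (ni_sent Hn Hq).
exact: (result1_would_receive r0 r_nf adm) k0 lt Hm.
Qed.
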